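(* For $a,b,c\in\mathbb Z_{\ge2}$, \begin{align*} &(1+(-1)^a)\zeta_3(a,b,c)+(1+(-1)^b)\{\zeta_3(b,a,c)+\zeta_3(b,c,a)\}+(-1)^b(1+(-1)^c)\zeta_3(c,b,a)\\ &=2\bigg\{\sum_{\xi=0}^{[a/2]}\zeta(2\xi)\sum_{\omega=0}^{a-2\xi}\binom{\omega+b-1}{\omega}\binom{a+c-2\xi-\omega-1}{c-1}\zeta_2(b+\omega,a+c-2\xi-\omega)\\ &\quad+\sum_{\xi=0}^{[b/2]}\zeta(2\xi)\sum_{\omega=0}^{a-1}\binom{\omega+b-2\xi}{\omega}\binom{a+c-\omega-2}{c-1}\zeta_2(b-2\xi+\omega+1,a+c-1-\omega)\\ &\quad+(-1)^b\sum_{\xi=0}^{[c/2]}\zeta(2\xi)\sum_{\omega=0}^{c-2\xi}\binom{\omega+b-1}{\omega}\binom{a+c-2\xi-\omega-1}{a-1}\zeta_2(b+\omega,a+c-2\xi-\omega)\\ &\quad+(-1)^b\sum_{\xi=0}^{[b/2]}\zeta(2\xi)\sum_{\omega=0}^{c-1}\binom{\omega+b-2\xi}{\omega}\binom{a+c-\omega-2}{a-1}\zeta_2(b-2\xi+\omega+1,a+c-1-\omega)\bigg\}\\ &\quad-\zeta_2(a+b,c)-(1+(-1)^b)\zeta_2(b,a+c)-(-1)^b\zeta_2(b+c,a). \end{align*}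
   Context: $\zeta_r(s_1,\ldots,s_r)=\sum_{0<n_1<\cdots<n_r}n_1^{-s_1}\cdots n_r^{-s_r}$ is the Euler–Zagier multiple zeta value (here $r=2,3$), $\zeta$ is the Riemann zeta-function (so $\zeta(0)=-1/2$), and $[x]$ denotes the integer part of $x$. *)

(* Defs.v *)
From Stdlib Require Import Reals.
From Coquelicot Require Import Coquelicot.
Open Scope R_scope.

Fixpoint hsum (s m : nat) : R :=
  match m with
  | O => 0
  | S m' => hsum s m' + / INR (S m') ^ s
  end.

Fixpoint hsum2 (s1 s2 m : nat) : R :=
  match m with
  | O => 0
  | S m' => hsum2 s1 s2 m' + hsum s1 m' / INR (S m') ^ s2
  end.

(* Riemann zeta at nonnegative integers used in the paper; zeta(0) = -1/2.
   (The value at s = 1 is never used.) *)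
Definition Rzeta (s : nat) : R :=
  match s with
  | O => - (1/2)
  | _ => Series (fun n => / INR (n + 1) ^ s)
  end.

(* Euler-Zagier double zeta: sum_{0<n1<n2} n1^{-s1} n2^{-s2},
   summed over the largest index n2 = m+1 (terms are nonnegative). *)
Definition zeta2 (s1 s2 : nat) : R :=
  Series (fun m => hsum s1 m / INR (m + 1) ^ s2).

Definition zeta3 (s1 s2 s3 : nat) : R :=
  Series (fun m => hsum2 s1 s2 m / INR (m + 1) ^ s3).

(* Main.v *)
Require Import Defs.
From Stdlib Require Import Reals Lra Lia List.
From Coquelicot Require Import Coquelicot.
Open Scope R_scope.

(** For integers [0 < m < n], sum [x^(-a) (m - x)^(-b) (n - x)^(-c)] over all integers [x]
other than [0], [m], [n]. Since [sum_{x <> 0} x^(-k)] is [2 zeta(k)] for even [k] and [0]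
for odd [k], partial fractions express this sum through the local expansions at the three
poles; the value [zeta(0) = -1/2] accounts for the two excluded points. Now sum over
[m < n]: the part [x < 0] gives [(-1)^a zeta_3(a,b,c)], the part [0 < x < m] gives
[zeta(a) zeta_2(b,c)], which the stuffle product expands, and the reflection
[x -> n - x], [m -> n - m] exchanges these two parts with [x > n] and [m < x < n], up to
sign and exchange of [a] and [c]. On the other side the poles [0] and [n] give the first
and third sums of the theorem, and the pole [m], after a further partial fraction
decomposition with respect to [m + (n - m) = n], gives the second and fourth. *)

(** * Finite sums and their reindexing *)

Fixpoint fsum (f : nat -> R) (n : nat) : R :=
  match n with O => 0 | S n' => fsum f n' + f n' end.

Lemma fsum_ext f g n :
  (forall i, (i < n)%nat -> f i = g i) -> fsum f n = fsum g n.
Proof.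
  induction n as [|n IH]; intros H; simpl; trivial.
  rewrite IH by (intros; apply H; lia). rewrite H by lia. reflexivity.
Qed.

Lemma fsum_plus f g n : fsum (fun i => f i + g i) n = fsum f n + fsum g n.
Proof. induction n; simpl; lra. Qed.

Lemma fsum_scal k f n : fsum (fun i => k * f i) n = k * fsum f n.
Proof. induction n; simpl; lra. Qed.

Lemma fsum_0 n : fsum (fun _ => 0) n = 0.
Proof. induction n; simpl; lra. Qed.

Lemma fsum_swap (f : nat -> nat -> R) n p :
  fsum (fun i => fsum (fun k => f i k) p) n = fsum (fun k => fsum (fun i => f i k) n) p.
Proof.
  induction n as [|n IH]; simpl.
  - now rewrite fsum_0.
  - now rewrite IH, fsum_plus.
Qed.

Lemma fsum_le f g n :
  (forall i, (i < n)%nat -> f i <= g i) -> fsum f n <= fsum g n.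
Proof.
  induction n as [|n IH]; intros H; simpl; try lra.
  apply Rplus_le_compat; [apply IH; intros; apply H|apply H]; lia.
Qed.

Lemma fsum_ge0 f n : (forall i, (i < n)%nat -> 0 <= f i) -> 0 <= fsum f n.
Proof. intros H. rewrite <- (fsum_0 n). now apply fsum_le. Qed.

Lemma fsum_incr f n p : (forall i, 0 <= f i) -> (n <= p)%nat -> fsum f n <= fsum f p.
Proof.
  intros H; induction 1; simpl; try lra. specialize (H m); lra.
Qed.

Lemma fsum_split f n p : fsum f (n + p) = fsum f n + fsum (fun i => f (n + i)%nat) p.
Proof.
  induction p as [|p IH]; simpl.
  - rewrite Nat.add_0_r; lra.
  - rewrite Nat.add_succ_r; simpl; lra.
Qed.

Lemma fsum_Sl f n : fsum f (S n) = f 0%nat + fsum (fun i => f (S i)) n.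
Proof. change (S n) with (1 + n)%nat. rewrite fsum_split. simpl. lra. Qed.

Lemma fsum_rev f n : fsum (fun i => f (n - 1 - i)%nat) n = fsum f n.
Proof.
  induction n as [|n IH]; trivial.
  rewrite fsum_Sl. replace (S n - 1 - 0)%nat with n by lia. simpl.
  rewrite <- IH, Rplus_comm. f_equal.
  apply fsum_ext; intros; f_equal; lia.
Qed.

(** Pairs [x < i] are sorted by [x] and by the gap, [i = S (x + y)]. This later isolates the
    smallest index of a triple sum and exhibits a Cauchy product. *)
Lemma fsum_triangle (f : nat -> nat -> R) n :
  fsum (fun i => fsum (fun x => f i x) i) n
  = fsum (fun x => fsum (fun y => f (S (x + y)) x) (n - 1 - x)) n.
Proof.
  induction n as [|n IH]; trivial. simpl fsum at 1 3. rewrite IH.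
  replace (n - 0 - n)%nat with 0%nat by lia. simpl fsum at 4. rewrite Rplus_0_r.
  rewrite <- fsum_plus. apply fsum_ext; intros x Hx.
  replace (n - 0 - x)%nat with (S (n - 1 - x)) by lia. simpl.
  do 2 f_equal. lia.
Qed.

Lemma fsum_sum_f_R0 f n : fsum f (S n) = sum_f_R0 f n.
Proof. induction n as [|n IH]; [simpl; lra|]. simpl in *. now rewrite IH. Qed.

Lemma fsum_sum_n f n : fsum f (S n) = sum_n f n.
Proof. now rewrite fsum_sum_f_R0, sum_n_Reals. Qed.

Lemma is_lim_seq_fsum (F : nat -> nat -> R) (L : nat -> R) n :
  (forall k, (k < n)%nat -> is_lim_seq (F k) (L k)) ->
  is_lim_seq (fun N => fsum (fun k => F k N) n) (fsum L n).
Proof.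
  induction n as [|n IH]; intros H; simpl.
  - apply is_lim_seq_const.
  - apply (is_lim_seq_plus' (fun N => fsum (fun k => F k N) n) (F n)).
    + apply IH; intros; apply H; lia.
    + apply H; lia.
Qed.

(** * Power series through their coefficients; negative powers *)

(** The coefficient of t^n in a product of power series. Series are handled only through
    coefficients, so no convergence in t is involved. *)
Definition conv (f g : nat -> R) (n : nat) : R :=
  fsum (fun k => f k * g (n - k)%nat) (S n).

(** Multiplication of a series by t. *)
Definition shift (f : nat -> R) (n : nat) : R :=
  match n with O => 0 | S n' => f n' end.

Lemma conv_ext f f' g g' n :
  (forall k, (k <= n)%nat -> f k = f' k) -> (forall k, (k <= n)%nat -> g k = g' k) ->
  conv f g n = conv f' g' n.
Proof.
  intros Hf Hg. apply fsum_ext; intros k Hk. rewrite Hf, Hg by lia. reflexivity.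
Qed.

Lemma conv_comm f g n : conv f g n = conv g f n.
Proof.
  unfold conv. rewrite <- fsum_rev. apply fsum_ext; intros k Hk.
  replace (S n - 1 - k)%nat with (n - k)%nat by lia.
  replace (n - (n - k))%nat with k by lia. ring.
Qed.

(** The recursions below all have the form [d * f = g - h], which survives convolution with a fixed
    series. *)
Lemma conv_lin_l d f g h F n :
  (forall k, d * f k = g k - h k) -> d * conv f F n = conv g F n - conv h F n.
Proof.
  intros H. unfold conv. rewrite <- fsum_scal.
  replace (fsum (fun k => g k * F (n - k)%nat) (S n) - fsum (fun k => h k * F (n - k)%nat) (S n))
    with (fsum (fun k => g k * F (n - k)%nat) (S n)
          + (-1) * fsum (fun k => h k * F (n - k)%nat) (S n)) by ring.
  rewrite <- fsum_scal, <- fsum_plus. apply fsum_ext; intros k _.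
  rewrite <- Rmult_assoc, H. ring.
Qed.

Lemma conv_lin_r d f g h F n :
  (forall k, d * f k = g k - h k) -> d * conv F f n = conv F g n - conv F h n.
Proof. intros H. rewrite !(conv_comm F). now apply conv_lin_l. Qed.

Lemma conv_shift_l f g n : conv (shift f) g n = shift (conv f g) n.
Proof.
  unfold conv. rewrite fsum_Sl. simpl shift at 1. rewrite Rmult_0_l, Rplus_0_l.
  destruct n as [|n]; reflexivity.
Qed.

Lemma conv_shift_r f g n : conv f (shift g) n = shift (conv f g) n.
Proof.
  rewrite conv_comm, conv_shift_l. destruct n; trivial. apply conv_comm.
Qed.

(* The coefficient of [t^k] in [(d + t)^(-s)]; the case [s = 0] is separate because
   [Binomial.C n k] is not [0] for [k > n]. *)
Definition negpow (d : R) (s k : nat) : R :=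
  match s with
  | O => match k with O => 1 | S _ => 0 end
  | S s' => (-1) ^ k * Binomial.C (k + s') k * / d ^ (s + k)
  end.

Lemma C_n_0 n : Binomial.C n 0 = 1.
Proof.
  unfold Binomial.C. rewrite Nat.sub_0_r. simpl. field. apply INR_fact_neq_0.
Qed.

Lemma C_n_n n : Binomial.C n n = 1.
Proof.
  unfold Binomial.C. rewrite Nat.sub_diag. simpl. field. apply INR_fact_neq_0.
Qed.

(** Compares coefficients in (d + t) (d + t)^(-s-1) = (d + t)^(-s); for positive [s] and [k] this is
    Pascal's rule. *)
Lemma negpow_rec d s k : d <> 0 ->
  d * negpow d (S s) k = negpow d s k - shift (negpow d (S s)) k.
Proof.
  intros Hd. destruct k as [|k]; cbn [shift].
  - destruct s as [|s]; unfold negpow; rewrite !C_n_0, ?Nat.add_0_r; simpl; field; trivial.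
    split; trivial. now apply pow_nonzero.
  - destruct s as [|s]; unfold negpow.
    + rewrite !Nat.add_0_r, !C_n_n. simpl. field. split; trivial. now apply pow_nonzero.
    + replace (S k + S s)%nat with (S (S (k + s))) by lia.
      rewrite <- (pascal (S (k + s)) k) by lia.
      replace (k + S s)%nat with (S (k + s)) by lia.
      replace (S k + s)%nat with (S (k + s)) by lia.
      replace (S (S s) + S k)%nat with (S (S (S (s + k)))) by lia.
      replace (S s + S k)%nat with (S (S (s + k))) by lia.
      replace (S (S s) + k)%nat with (S (S (s + k))) by lia.
      simpl. field. split; trivial. now apply pow_nonzero.
Qed.

Lemma negpow_0 d s : negpow d s 0 = / d ^ s.
Proof.
  destruct s; unfold negpow; rewrite ?C_n_0, ?Nat.add_0_r; simpl; [field|ring].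
Qed.

(** From y - x = (y + t) - (x + t), where each bracket cancels one factor; the two terms carrying a
    factor t drop out. *)
Lemma conv_negpow_sub x y a b k : x <> 0 -> y <> 0 ->
  (y - x) * conv (negpow x (S a)) (negpow y (S b)) k
  = conv (negpow x (S a)) (negpow y b) k - conv (negpow x a) (negpow y (S b)) k.
Proof.
  intros Hx Hy. rewrite Rmult_minus_distr_r.
  rewrite (conv_lin_r y _ (negpow y b) (shift (negpow y (S b))))
    by (intros; now apply negpow_rec).
  rewrite (conv_lin_l x _ (negpow x a) (shift (negpow x (S a))))
    by (intros; now apply negpow_rec).
  rewrite conv_shift_l, conv_shift_r. ring.
Qed.

Lemma conv_negpow_0 f d n : conv f (negpow d 0) n = f n.
Proof.
  unfold conv. simpl fsum. rewrite Nat.sub_diag. simpl.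
  rewrite (fsum_ext _ (fun _ => 0)), fsum_0; [ring|].
  intros i Hi. destruct (n - i)%nat eqn:E; [lia|ring].
Qed.

(** * The residue side of the summation formula *)

(** The coefficients of -pi t cot(pi t). The value zeta(0) = -1/2 makes the constant term -1 fit the
    formula for even [k]. *)
Definition zcoef (k : nat) : R := if Nat.even k then 2 * Rzeta k else 0.

Lemma zcoef_0 : zcoef 0 = -1.
Proof. unfold zcoef; simpl; lra. Qed.

(* Minus the sum of the residues of [pi * cot (pi * x) * rat3 r1 r2 r3 a b c x] at the
   poles [r1], [r2], [r3], when these are integers. *)
Definition residues (r1 r2 r3 : R) (a b c : nat) : R :=
  conv zcoef (conv (negpow (r2 - r1) b) (negpow (r3 - r1) c)) a
  + conv zcoef (conv (negpow (r1 - r2) a) (negpow (r3 - r2) c)) b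
  + conv zcoef (conv (negpow (r1 - r3) a) (negpow (r2 - r3) b)) c.

Definition rat3 (r1 r2 r3 : R) (a b c : nat) (x : R) : R :=
  / (r1 - x) ^ a * / (r2 - x) ^ b * / (r3 - x) ^ c.

Lemma residues_swap12 r1 r2 r3 a b c :
  residues r1 r2 r3 a b c = residues r2 r1 r3 b a c.
Proof.
  unfold residues.
  rewrite (conv_ext zcoef zcoef (conv (negpow (r1 - r3) a) (negpow (r2 - r3) b))
    (conv (negpow (r2 - r3) b) (negpow (r1 - r3) a)) c); trivial; [ring|].
  intros; apply conv_comm.
Qed.

Lemma residues_swap23 r1 r2 r3 a b c :
  residues r1 r2 r3 a b c = residues r1 r3 r2 a c b.
Proof.
  unfold residues.
  rewrite (conv_ext zcoef zcoef (conv (negpow (r2 - r1) b) (negpow (r3 - r1) c))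
    (conv (negpow (r3 - r1) c) (negpow (r2 - r1) b)) a); trivial; [ring|].
  intros; apply conv_comm.
Qed.

(** The series of [h] enters with a factor t, which lowers the order of the pole by one: hence the
    index [n] next to [S n]. *)
Lemma conv_zcoef_rec d f g h n :
  (forall k, d * f k = g k - shift h k) ->
  d * conv zcoef f (S n) = conv zcoef g (S n) - conv zcoef h n.
Proof.
  intros H. rewrite (conv_lin_r d f g (shift h)) by trivial.
  now rewrite conv_shift_r.
Qed.

(** This is the recursion that [rat3] inherits from r2 - r1 = (r2 - x) - (r1 - x). At r1 and at r2
    one bracket is the local parameter, hence a shift; at r3 both brackets are invertible series. *)
Lemma residues_rec r1 r2 r3 a b c : r1 <> r2 -> r1 <> r3 -> r2 <> r3 ->
  (r2 - r1) * residues r1 r2 r3 (S a) (S b) c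
  = residues r1 r2 r3 (S a) b c - residues r1 r2 r3 a (S b) c.
Proof.
  intros H12 H13 H23. unfold residues. rewrite !Rmult_plus_distr_l.
  rewrite (conv_zcoef_rec (r2 - r1) (conv (negpow (r2 - r1) (S b)) (negpow (r3 - r1) c))
    (conv (negpow (r2 - r1) b) (negpow (r3 - r1) c))
    (conv (negpow (r2 - r1) (S b)) (negpow (r3 - r1) c)) a).
  2:{ intros k. rewrite <- conv_shift_l. apply conv_lin_l. intros; apply negpow_rec; lra. }
  (* At r2 the other pole sits at r1 - r2, so the factor changes sign. *)
  replace ((r2 - r1) * conv zcoef (conv (negpow (r1 - r2) (S a)) (negpow (r3 - r2) c)) (S b))
    with (- ((r1 - r2) * conv zcoef (conv (negpow (r1 - r2) (S a)) (negpow (r3 - r2) c)) (S b)))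
    by ring.
  rewrite (conv_zcoef_rec (r1 - r2) (conv (negpow (r1 - r2) (S a)) (negpow (r3 - r2) c))
    (conv (negpow (r1 - r2) a) (negpow (r3 - r2) c))
    (conv (negpow (r1 - r2) (S a)) (negpow (r3 - r2) c)) b).
  2:{ intros k. rewrite <- conv_shift_l. apply conv_lin_l. intros; apply negpow_rec; lra. }
  rewrite (conv_lin_r (r2 - r1) (conv (negpow (r1 - r3) (S a)) (negpow (r2 - r3) (S b)))
    (conv (negpow (r1 - r3) (S a)) (negpow (r2 - r3) b))
    (conv (negpow (r1 - r3) a) (negpow (r2 - r3) (S b)))); [ring|].
  intros k. replace (r2 - r1) with ((r2 - r3) - (r1 - r3)) by ring.
  apply conv_negpow_sub; lra.
Qed.

(** * The summation formula, by recursion on the weight *)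

Definition lsum (f : R -> R) (l : list R) : R := fold_right (fun x s => f x + s) 0 l.

Lemma lsum_lin d f g h l :
  (forall x, In x l -> d * f x = g x - h x) -> d * lsum f l = lsum g l - lsum h l.
Proof.
  induction l as [|x l IH]; intros H; simpl; [ring|].
  rewrite Rmult_plus_distr_l, IH by (intros; apply H; now right).
  rewrite H by now left. ring.
Qed.

Lemma lsum_ext f g l : (forall x, In x l -> f x = g x) -> lsum f l = lsum g l.
Proof.
  induction l as [|x l IH]; intros H; simpl; trivial.
  rewrite IH by (intros; apply H; now right). rewrite H by now left. reflexivity.
Qed.

Lemma lsum_app f l l' : lsum f (l ++ l') = lsum f l + lsum f l'.
Proof. induction l as [|x l IH]; simpl; [ring|]. rewrite IH; ring. Qed.

Lemma lsum_map_seq f g n : lsum f (map g (seq 0 n)) = fsum (fun i => f (g i)) n.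
Proof.
  induction n as [|n IH]; trivial.
  rewrite seq_S, map_app, lsum_app, IH. simpl. ring.
Qed.

(* [P M] exhausts the integers other than [r1], [r2], [r3] symmetrically enough for the
   sums of [(r - x)^(-k)] over [P M] to converge, even when [k = 1]. *)
Definition pole_sum (P : nat -> list R) (r1 r2 r3 : R) : Prop :=
  forall k, is_lim_seq (fun M => lsum (fun x => / (r1 - x) ^ S k) (P M))
    (zcoef (S k) - / (r1 - r2) ^ S k - / (r1 - r3) ^ S k).

Definition exhausts (P : nat -> list R) (r1 r2 r3 : R) : Prop :=
  (r1 <> r2 /\ r1 <> r3 /\ r2 <> r3) /\
  (forall M x, In x (P M) -> r1 <> x /\ r2 <> x /\ r3 <> x) /\
  pole_sum P r1 r2 r3 /\ pole_sum P r2 r1 r3 /\ pole_sum P r3 r1 r2.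

Lemma pole_sum_swap P r1 r2 r3 : pole_sum P r1 r2 r3 -> pole_sum P r1 r3 r2.
Proof.
  intros H k. replace (zcoef (S k) - / (r1 - r3) ^ S k - / (r1 - r2) ^ S k)
    with (zcoef (S k) - / (r1 - r2) ^ S k - / (r1 - r3) ^ S k) by ring. apply H.
Qed.

Lemma exhausts_swap12 P r1 r2 r3 : exhausts P r1 r2 r3 -> exhausts P r2 r1 r3.
Proof.
  intros [(H1 & H2 & H3) [H4 (H5 & H6 & H7)]]. repeat split; auto; try apply (H4 _ _ H).
  now apply pole_sum_swap.
Qed.

Lemma exhausts_swap23 P r1 r2 r3 : exhausts P r1 r2 r3 -> exhausts P r1 r3 r2.
Proof.
  intros [(H1 & H2 & H3) [H4 (H5 & H6 & H7)]].
  repeat split; auto; try apply (H4 _ _ H); now apply pole_sum_swap.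
Qed.

(** The conclusion of the residue theorem for pi cot(pi x) times [rat3]. *)
Definition rat3_sum P r1 r2 r3 a b c : Prop :=
  is_lim_seq (fun M => lsum (rat3 r1 r2 r3 a b c) (P M)) (residues r1 r2 r3 a b c).

Lemma rat3_sum_swap12 P r1 r2 r3 a b c :
  rat3_sum P r2 r1 r3 b a c -> rat3_sum P r1 r2 r3 a b c.
Proof.
  unfold rat3_sum. rewrite residues_swap12. apply is_lim_seq_ext; intros M.
  apply lsum_ext; intros x _. unfold rat3; ring.
Qed.

Lemma rat3_sum_swap23 P r1 r2 r3 a b c :
  rat3_sum P r1 r3 r2 a c b -> rat3_sum P r1 r2 r3 a b c.
Proof.
  unfold rat3_sum. rewrite residues_swap23. apply is_lim_seq_ext; intros M.
  apply lsum_ext; intros x _. unfold rat3; ring.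
Qed.

(** With no pole at r2 and r3, these points still contribute: the constant term [zcoef 0 = -1]
    subtracts exactly the two points missing from [P]. *)
Lemma rat3_sum_one_pole P r1 r2 r3 a :
  exhausts P r1 r2 r3 -> rat3_sum P r1 r2 r3 (S a) 0 0.
Proof.
  intros [_ [_ (H & _ & _)]]. unfold rat3_sum, residues.
  rewrite (conv_ext zcoef zcoef (conv (negpow (r2 - r1) 0) (negpow (r3 - r1) 0))
    (negpow (r2 - r1) 0) (S a)); trivial.
  2:{ intros; apply conv_negpow_0. }
  rewrite conv_negpow_0. unfold conv at 1 3. simpl fsum. rewrite !conv_negpow_0, !negpow_0.
  rewrite zcoef_0.
  replace (zcoef (S a) + (0 + -1 * / (r1 - r2) ^ S a) + (0 + -1 * / (r1 - r3) ^ S a))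
    with (zcoef (S a) - / (r1 - r2) ^ S a - / (r1 - r3) ^ S a) by ring.
  eapply is_lim_seq_ext; [|apply H].
  intros M; apply lsum_ext; intros x _. unfold rat3. simpl. rewrite Rinv_1. ring.
Qed.

(** Both sides obey the same recursion with the nonzero factor r2 - r1; away from the poles it can
    be checked pointwise. *)
Lemma rat3_sum_step P r1 r2 r3 a b c : exhausts P r1 r2 r3 ->
  rat3_sum P r1 r2 r3 (S a) b c -> rat3_sum P r1 r2 r3 a (S b) c ->
  rat3_sum P r1 r2 r3 (S a) (S b) c.
Proof.
  intros [(H12 & H13 & H23) [Hoff _]] H1 H2. unfold rat3_sum.
  assert (E : residues r1 r2 r3 (S a) (S b) c = / (r2 - r1) *
    (residues r1 r2 r3 (S a) b c - residues r1 r2 r3 a (S b) c)).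
  { rewrite <- residues_rec by trivial. field. lra. }
  rewrite E.
  apply is_lim_seq_ext with (fun M => / (r2 - r1) *
    (lsum (rat3 r1 r2 r3 (S a) b c) (P M) - lsum (rat3 r1 r2 r3 a (S b) c) (P M))).
  - intros M. rewrite <- (lsum_lin (r2 - r1) (rat3 r1 r2 r3 (S a) (S b) c)); [field; lra|].
    intros x Hx. destruct (Hoff M x Hx) as (Hx1 & Hx2 & Hx3). unfold rat3. simpl. field.
    repeat split; try apply pow_nonzero; lra.
  - apply (is_lim_seq_scal_l _ (/ (r2 - r1))
      (residues r1 r2 r3 (S a) b c - residues r1 r2 r3 a (S b) c)).
    now apply is_lim_seq_minus'.
Qed.

(** Induction on the weight: two positive exponents allow a step down, otherwise a single pole
    remains. The exchanges bring the positive exponents to the front. *)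
Lemma rat3_sum_lim P w : forall r1 r2 r3 a b c, (a + b + c = S w)%nat ->
  exhausts P r1 r2 r3 -> rat3_sum P r1 r2 r3 a b c.
Proof.
  induction w as [|w IH]; intros r1 r2 r3 a b c Hw HP.
  - destruct a as [|a]; [destruct b as [|b]|].
    + replace c with 1%nat by lia. apply rat3_sum_swap23, rat3_sum_swap12, rat3_sum_one_pole.
      now apply exhausts_swap12, exhausts_swap23.
    + replace (S b) with 1%nat by lia. replace c with 0%nat by lia.
      apply rat3_sum_swap12, rat3_sum_one_pole. now apply exhausts_swap12.
    + replace b with 0%nat by lia. replace c with 0%nat by lia. now apply rat3_sum_one_pole.
  - destruct a as [|a], b as [|b]; [| |destruct c as [|c]|].
    + replace c with (S (S w)) by lia.
      apply rat3_sum_swap23, rat3_sum_swap12, rat3_sum_one_pole.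
      now apply exhausts_swap12, exhausts_swap23.
    + destruct c as [|c].
      * apply rat3_sum_swap12, rat3_sum_one_pole. now apply exhausts_swap12.
      * apply rat3_sum_swap12, rat3_sum_swap23.
        assert (HP' : exhausts P r2 r3 r1) by now apply exhausts_swap23, exhausts_swap12.
        apply rat3_sum_step; trivial; apply IH; trivial; lia.
    + now apply rat3_sum_one_pole.
    + assert (HP' : exhausts P r1 r3 r2) by now apply exhausts_swap23.
      apply rat3_sum_swap23, rat3_sum_step; trivial; apply IH; trivial; lia.
    + apply rat3_sum_step; trivial; apply IH; trivial; lia.
Qed.

(** * Truncated multiple zeta values and their convergence *)

Lemma hsum_fsum s n : hsum s n = fsum (fun i => / INR (S i) ^ s) n.
Proof. induction n as [|n IH]; trivial. cbn [hsum]. now rewrite IH. Qed.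

Lemma hsum2_fsum s1 s2 n : hsum2 s1 s2 n = fsum (fun i => hsum s1 i * / INR (S i) ^ s2) n.
Proof. induction n as [|n IH]; trivial. cbn [hsum2]. now rewrite IH. Qed.

Definition hsum3 (s1 s2 s3 n : nat) : R :=
  fsum (fun i => hsum2 s1 s2 i * / INR (S i) ^ s3) n.

Lemma INR_S_ge1 i : 1 <= INR (S i).
Proof. rewrite S_INR. pose proof (pos_INR i). lra. Qed.

Lemma INR_S_gt0 i : 0 < INR (S i).
Proof. pose proof (INR_S_ge1 i). lra. Qed.

Lemma inv_pow_pos i s : 0 < / INR (S i) ^ s.
Proof. apply Rinv_0_lt_compat, pow_lt, INR_S_gt0. Qed.

Lemma inv_pow_le i s t : (s <= t)%nat -> / INR (S i) ^ t <= / INR (S i) ^ s.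
Proof.
  intros H. apply Rinv_le_contravar; [apply pow_lt, INR_S_gt0|].
  apply Rle_pow; trivial. apply INR_S_ge1.
Qed.

Lemma hsum_ge0 s n : 0 <= hsum s n.
Proof. rewrite hsum_fsum. apply fsum_ge0; intros; apply Rlt_le, inv_pow_pos. Qed.

Lemma hsum2_term_ge0 s1 s2 i : 0 <= hsum s1 i * / INR (S i) ^ s2.
Proof. apply Rmult_le_pos; [apply hsum_ge0|apply Rlt_le, inv_pow_pos]. Qed.

Lemma hsum2_ge0 s1 s2 n : 0 <= hsum2 s1 s2 n.
Proof. rewrite hsum2_fsum. apply fsum_ge0; intros; apply hsum2_term_ge0. Qed.

Lemma hsum_incr s n p : (n <= p)%nat -> hsum s n <= hsum s p.
Proof.
  intros H. rewrite !hsum_fsum. apply fsum_incr; trivial. intros; apply Rlt_le, inv_pow_pos.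
Qed.

(** Larger exponents are dominated by exponent 2, where 1/(x+1)^2 <= 1/x - 1/(x+1) telescopes. *)
Lemma hsum_bound s n : (2 <= s)%nat -> hsum s n <= 2.
Proof.
  intros Hs. apply Rle_trans with (hsum 2 n).
  - rewrite !hsum_fsum. apply fsum_le; intros; now apply inv_pow_le.
  - enough (H : hsum 2 (S n) <= 2 - / INR (S n)).
    { pose proof (hsum_incr 2 n (S n) (Nat.le_succ_diag_r n)).
      pose proof (Rinv_0_lt_compat _ (INR_S_gt0 n)). lra. }
    induction n as [|n IH]; [simpl; lra|].
    change (hsum 2 (S (S n))) with (hsum 2 (S n) + / INR (S (S n)) ^ 2).
    pose proof (INR_S_gt0 n) as Hn. rewrite (S_INR (S n)).
    set (x := INR (S n)) in *.
    assert (/ (x + 1) ^ 2 <= / x - / (x + 1)); [|lra].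
    replace (/ x - / (x + 1)) with (/ (x * (x + 1))) by (field; lra).
    apply Rinv_le_contravar; nra.
Qed.

(* Telescoping: [(H_n + 1) / n] decreases by at least [H_(n-1) / n^2] at each step. *)
Lemma hsum2_bound s1 s2 n : (1 <= s1)%nat -> (2 <= s2)%nat -> hsum2 s1 s2 n <= 2.
Proof.
  intros H1 H2. apply Rle_trans with (hsum2 1 2 n).
  - rewrite !hsum2_fsum. apply fsum_le; intros i _.
    apply Rmult_le_compat; [apply hsum_ge0|apply Rlt_le, inv_pow_pos| |now apply inv_pow_le].
    rewrite !hsum_fsum. apply fsum_le; intros; now apply inv_pow_le.
  - enough (H : hsum2 1 2 (S n) <= 2 - (hsum 1 (S n) + 1) / INR (S n)).
    { assert (0 <= (hsum 1 (S n) + 1) / INR (S n)).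
      { apply Rdiv_le_0_compat; [pose proof (hsum_ge0 1 (S n)); lra|apply INR_S_gt0]. }
      pose proof (hsum2_term_ge0 1 2 n) as H'.
      change (hsum2 1 2 (S n)) with (hsum2 1 2 n + hsum 1 n * / INR (S n) ^ 2) in H. lra. }
    induction n as [|n IH]; [simpl; lra|].
    change (hsum2 1 2 (S (S n))) with (hsum2 1 2 (S n) + hsum 1 (S n) / INR (S (S n)) ^ 2).
    change (hsum 1 (S (S n))) with (hsum 1 (S n) + / INR (S (S n)) ^ 1).
    pose proof (INR_S_gt0 n) as Hn. rewrite (S_INR (S n)).
    set (x := INR (S n)) in *. pose proof (hsum_ge0 1 (S n)) as Hh.
    set (h := hsum 1 (S n)) in *.
    assert (E : (h + 1) / x - (h + / (x + 1) ^ 1 + 1) / (x + 1) - h / (x + 1) ^ 2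
      = (h + 1) / (x * (x + 1) ^ 2)) by (field; lra).
    assert (0 <= (h + 1) / (x * (x + 1) ^ 2)); [|lra].
    apply Rdiv_le_0_compat; [lra|]. apply Rmult_lt_0_compat; trivial. apply pow_lt; lra.
Qed.

Lemma hsum3_bound s1 s2 s3 n :
  (1 <= s1)%nat -> (2 <= s2)%nat -> (2 <= s3)%nat -> hsum3 s1 s2 s3 n <= 4.
Proof.
  (* The inner double sum is at most 2, and so is the remaining single sum. *)
  intros H1 H2 H3. apply Rle_trans with (2 * hsum s3 n).
  - unfold hsum3. rewrite hsum_fsum, <- fsum_scal. apply fsum_le; intros i _.
    apply Rmult_le_compat_r; [apply Rlt_le, inv_pow_pos|now apply hsum2_bound].
  - pose proof (hsum_bound s3 n H3). lra.
Qed.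

Lemma is_series_fsum t l : is_series t l <-> is_lim_seq (fsum t) l.
Proof.
  (* [sum_n t n] includes the term of index [n], whereas [fsum t n] stops before it. *)
  rewrite is_lim_seq_incr_1. split; intros H.
  - apply is_lim_seq_ext with (sum_n t); [intros; now rewrite fsum_sum_n|exact H].
  - change (is_lim_seq (sum_n t) l).
    apply is_lim_seq_ext with (2 := H). intros; apply fsum_sum_n.
Qed.

Lemma bounded_series t B : (forall k, 0 <= t k) -> (forall n, fsum t n <= B) -> ex_series t.
Proof.
  intros H0 HB.
  destruct (ex_finite_lim_seq_incr (fsum t) B) as [l Hl]; trivial.
  - intros n; simpl. specialize (H0 n); lra.
  - exists l. now apply is_series_fsum.
Qed.

Lemma lim_fsum_Series t : ex_series t -> is_lim_seq (fsum t) (Series t).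
Proof. intros H. now apply is_series_fsum, Series_correct. Qed.

Lemma ex_series_hsum s : (2 <= s)%nat -> ex_series (fun i => / INR (S i) ^ s).
Proof.
  intros H. apply bounded_series with 2; [intros; apply Rlt_le, inv_pow_pos|].
  intros; rewrite <- hsum_fsum; now apply hsum_bound.
Qed.

Lemma hsum_lim s : (2 <= s)%nat -> is_lim_seq (hsum s) (Rzeta s).
Proof.
  intros H. replace (Rzeta s) with (Series (fun i => / INR (S i) ^ s)).
  - eapply is_lim_seq_ext; [|apply lim_fsum_Series; now apply ex_series_hsum].
    intros; symmetry; apply hsum_fsum.
  - destruct s as [|s]; [lia|]. apply Series_ext; intros n. now rewrite Nat.add_1_r.
Qed.

Lemma ex_series_hsum2 s1 s2 : (1 <= s1)%nat -> (2 <= s2)%nat ->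
  ex_series (fun i => hsum s1 i * / INR (S i) ^ s2).
Proof.
  intros H1 H2. apply bounded_series with 2; [intros; apply hsum2_term_ge0|].
  intros; rewrite <- hsum2_fsum; now apply hsum2_bound.
Qed.

Lemma zeta2_Series s1 s2 : zeta2 s1 s2 = Series (fun i => hsum s1 i * / INR (S i) ^ s2).
Proof. apply Series_ext; intros n. now rewrite Nat.add_1_r. Qed.

Lemma hsum2_lim s1 s2 : (1 <= s1)%nat -> (2 <= s2)%nat ->
  is_lim_seq (hsum2 s1 s2) (zeta2 s1 s2).
Proof.
  intros H1 H2. rewrite zeta2_Series.
  eapply is_lim_seq_ext; [|apply lim_fsum_Series; now apply ex_series_hsum2].
  intros; symmetry; apply hsum2_fsum.
Qed.

Lemma hsum3_term_ge0 s1 s2 s3 i : 0 <= hsum2 s1 s2 i * / INR (S i) ^ s3.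
Proof. apply Rmult_le_pos; [apply hsum2_ge0|apply Rlt_le, inv_pow_pos]. Qed.

Lemma hsum3_lim s1 s2 s3 : (1 <= s1)%nat -> (2 <= s2)%nat -> (2 <= s3)%nat ->
  is_lim_seq (hsum3 s1 s2 s3) (zeta3 s1 s2 s3).
Proof.
  intros H1 H2 H3.
  replace (zeta3 s1 s2 s3) with (Series (fun i => hsum2 s1 s2 i * / INR (S i) ^ s3)).
  - apply lim_fsum_Series, bounded_series with 4; [intros; apply hsum3_term_ge0|].
    intros; now apply hsum3_bound.
  - apply Series_ext; intros n. now rewrite Nat.add_1_r.
Qed.

Lemma hsum3_le_zeta3 s1 s2 s3 n : (1 <= s1)%nat -> (2 <= s2)%nat -> (2 <= s3)%nat ->
  hsum3 s1 s2 s3 n <= zeta3 s1 s2 s3.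
Proof.
  intros H1 H2 H3. apply (is_lim_seq_incr_compare (hsum3 s1 s2 s3)).
  - now apply hsum3_lim.
  - intros k. unfold hsum3; cbn [fsum]. pose proof (hsum3_term_ge0 s1 s2 s3 k). lra.
Qed.

(** * The stuffle product *)

(** The index of the single sum lies below, between or above the two others, or equals one of them.
    All indices share the cutoff [n], so the identity is exact before the limit. *)
Lemma hsum_mul_hsum2 a b c n :
  hsum a n * hsum2 b c n = hsum3 a b c n + hsum3 b a c n + hsum3 b c a n
    + hsum2 (a + b) c n + hsum2 b (a + c) n.
Proof.
  assert (H2 : forall k, hsum a k * hsum b k = hsum2 a b k + hsum2 b a k + hsum (a + b) k).
  { induction k as [|k IH]; [simpl; ring|]. cbn [hsum]; cbn [hsum2].
    rewrite pow_add, Rinv_mult, Rmult_plus_distr_r, !Rmult_plus_distr_l, IH.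
    unfold Rdiv; ring. }
  induction n as [|n IH]; [unfold hsum3; simpl; ring|].
  unfold hsum3 in *; cbn [fsum]; cbn [hsum]; cbn [hsum2].
  unfold Rdiv. rewrite pow_add, Rinv_mult, Rmult_plus_distr_r, !Rmult_plus_distr_l, IH.
  rewrite <- (Rmult_assoc (hsum a n)), H2. ring.
Qed.

Lemma Rzeta_mul_zeta2 a b c : (2 <= a)%nat -> (2 <= b)%nat -> (2 <= c)%nat ->
  Rzeta a * zeta2 b c = zeta3 a b c + zeta3 b a c + zeta3 b c a
    + zeta2 (a + b) c + zeta2 b (a + c).
Proof.
  intros Ha Hb Hc.
  assert (H : is_lim_seq (fun n => hsum a n * hsum2 b c n) (Rzeta a * zeta2 b c)).
  { apply is_lim_seq_mult'; [now apply hsum_lim|apply hsum2_lim; lia]. }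
  apply is_lim_seq_unique in H.
  rewrite (Lim_seq_ext _ _ (hsum_mul_hsum2 a b c)) in H.
  assert (H' : is_lim_seq (fun n => hsum3 a b c n + hsum3 b a c n + hsum3 b c a n
    + hsum2 (a + b) c n + hsum2 b (a + c) n)
    (zeta3 a b c + zeta3 b a c + zeta3 b c a + zeta2 (a + b) c + zeta2 b (a + c))).
  { apply is_lim_seq_plus'; [|apply hsum2_lim; lia].
    apply is_lim_seq_plus'; [|apply hsum2_lim; lia].
    apply is_lim_seq_plus'; [|apply hsum3_lim; lia].
    apply is_lim_seq_plus'; apply hsum3_lim; lia. }
  apply is_lim_seq_unique in H'. rewrite H in H'. now injection H'.
Qed.

(** * Symmetric sums over the integers around three poles *)

(** The difference has [p] terms, each at most 1/(M+1). This covers exponent 1, where the two sums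
    diverge separately. *)
Lemma hsum_gap k p : is_lim_seq (fun M => hsum (S k) (p + M) - hsum (S k) M) 0.
Proof.
  induction p as [|p IH].
  - apply is_lim_seq_ext with (fun _ => 0); [intros; simpl; ring|apply is_lim_seq_const].
  - apply is_lim_seq_ext with
      (fun M => hsum (S k) (p + M) - hsum (S k) M + / INR (S (p + M)) ^ S k).
    { intros M. rewrite Nat.add_succ_l. cbn [hsum]. ring. }
    replace 0 with (0 + 0) by ring. apply is_lim_seq_plus'; trivial.
    apply is_lim_seq_le_le with (fun _ => 0) (fun M => / INR (S M)).
    + intros M; split; [apply Rlt_le, inv_pow_pos|].
      apply Rle_trans with (/ INR (S (p + M)) ^ 1); [apply inv_pow_le; lia|].
      rewrite pow_1. apply Rinv_le_contravar; [apply INR_S_gt0|apply le_INR; lia].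
    + apply is_lim_seq_const.
    + apply (is_lim_seq_incr_1 (fun M => / INR M)).
      apply (is_lim_seq_inv INR p_infty); [apply is_lim_seq_INR|discriminate].
Qed.

Lemma pow_m1_even k : Nat.even k = true -> (-1) ^ k = 1.
Proof. intros H. apply Nat.even_spec in H. destruct H as [j ->]. apply pow_1_even. Qed.

Lemma pow_m1_odd k : Nat.even k = false -> (-1) ^ k = -1.
Proof.
  intros H. assert (H' : Nat.odd k = true) by (unfold Nat.odd; now rewrite H).
  apply Nat.odd_spec in H'. destruct H' as [j ->].
  replace (2 * j + 1)%nat with (S (2 * j)) by lia. apply pow_1_odd.
Qed.

Lemma pow_m1_cases k : (-1) ^ k = 1 \/ (-1) ^ k = -1.
Proof. destruct (Nat.even k) eqn:E; [left; now apply pow_m1_even|right; now apply pow_m1_odd]. Qed.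

(** The two sums come from the two sides of a pole, cut off at different distances. For even
    exponents both tend to zeta; for odd ones they cancel up to [hsum_gap]. *)
Lemma zcoef_lim k p q :
  is_lim_seq (fun M => hsum (S k) (p + M) + (-1) ^ S k * hsum (S k) (q + M)) (zcoef (S k)).
Proof.
  unfold zcoef. destruct (Nat.even (S k)) eqn:E.
  - rewrite (pow_m1_even _ E).
    assert (Hk : (2 <= S k)%nat) by (destruct k; [discriminate|lia]).
    assert (H : forall r, is_lim_seq (fun M => hsum (S k) (r + M)) (Rzeta (S k))).
    { intros r. apply is_lim_seq_ext with (fun M => hsum (S k) (M + r)).
      - intros; now rewrite Nat.add_comm.
      - now apply is_lim_seq_incr_n, hsum_lim. }
    replace (2 * Rzeta (S k)) with (Rzeta (S k) + Rzeta (S k)) by ring.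
    apply is_lim_seq_ext with (fun M => hsum (S k) (p + M) + hsum (S k) (q + M)).
    + intros; ring.
    + now apply is_lim_seq_plus'.
  - rewrite (pow_m1_odd _ E). replace 0 with (0 - 0) by ring.
    apply is_lim_seq_ext with
      (fun M => (hsum (S k) (p + M) - hsum (S k) M) - (hsum (S k) (q + M) - hsum (S k) M)).
    + intros; ring.
    + apply is_lim_seq_minus'; apply hsum_gap.
Qed.

(* The integers from [-M] to [n + M] except [0], [m], [n], where [m = S i] and
   [n - m = S p]. *)
Definition window (i p M : nat) : list R :=
  map (fun u => - INR (S u)) (seq 0 M)
  ++ map (fun x => INR (S x)) (seq 0 i)
  ++ map (fun y => INR (S i) + INR (S y)) (seq 0 p)
  ++ map (fun z => INR (S i) + INR (S p) + INR (S z)) (seq 0 M).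

Lemma lsum_window f i p M :
  lsum f (window i p M) = fsum (fun u => f (- INR (S u))) M
  + fsum (fun x => f (INR (S x))) i
  + fsum (fun y => f (INR (S i) + INR (S y))) p
  + fsum (fun z => f (INR (S i) + INR (S p) + INR (S z))) M.
Proof. unfold window. rewrite !lsum_app, !lsum_map_seq. ring. Qed.

Lemma hsum_shift k n p f : (forall y, (y < p)%nat -> f y = INR n + INR (S y)) ->
  fsum (fun y => / f y ^ k) p = hsum k (n + p) - hsum k n.
Proof.
  intros H. rewrite !hsum_fsum, fsum_split. ring_simplify. apply fsum_ext; intros y Hy.
  now rewrite H, <- plus_INR, Nat.add_succ_r by trivial.
Qed.

Lemma hsum_rev k n p f : (forall y, (y < p)%nat -> f y = INR (n + (p - y))) ->
  fsum (fun y => / f y ^ k) p = hsum k (n + p) - hsum k n.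
Proof.
  intros H. rewrite <- fsum_rev. apply hsum_shift with (f := fun y => f (p - 1 - y)%nat).
  intros y Hy. rewrite H, <- plus_INR by lia. f_equal. lia.
Qed.

Lemma inv_pow_opp x k : / (- x) ^ k = (-1) ^ k * / x ^ k.
Proof.
  replace (- x) with ((-1) * x) by ring. rewrite Rpow_mult_distr, Rinv_mult. f_equal.
  destruct (pow_m1_cases k) as [-> | ->]; lra.
Qed.

Lemma fsum_neg k n f g : (forall y, (y < n)%nat -> f y = - g y) ->
  fsum (fun y => / f y ^ k) n = (-1) ^ k * fsum (fun y => / g y ^ k) n.
Proof.
  intros H. rewrite <- fsum_scal. apply fsum_ext; intros y Hy.
  now rewrite H, inv_pow_opp.
Qed.

(** Once the two other poles are restored, each pole sees all distances up to a cutoff on either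
    side. The left and right cutoffs are M and n + M at 0, m + M and n - m + M at m, n + M and M at
    n, so [zcoef_lim] applies. *)
Lemma window_exhausts i p :
  exhausts (window i p) 0 (INR (S i)) (INR (S i) + INR (S p)).
Proof.
  pose proof (INR_S_gt0 i) as Hi. pose proof (INR_S_gt0 p) as Hp.
  set (j := (S i + S p)%nat).
  assert (Hj : INR (S i) + INR (S p) = INR j) by (unfold j; now rewrite plus_INR).
  split; [repeat split; lra|].
  split.
  - intros M x Hx. unfold window in Hx. rewrite !in_app_iff, !in_map_iff in Hx.
    destruct Hx as [(u & <- & Hu)|[(u & <- & Hu)|[(u & <- & Hu)|(u & <- & Hu)]]];
      apply in_seq in Hu; pose proof (INR_S_gt0 u).
    + lra.
    + assert (INR (S u) < INR (S i)) by (apply lt_INR; lia). lra.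
    + assert (INR (S u) < INR (S p)) by (apply lt_INR; lia). lra.
    + lra.
  - assert (Z : forall x, / x ^ 0 = 1) by (intros; simpl; apply Rinv_1).
    split; [|split]; intros k.
    + eapply is_lim_seq_ext with (fun M =>
        (hsum (S k) (0 + M) + (-1) ^ S k * hsum (S k) (j + M))
         - / (0 - INR (S i)) ^ S k - / (0 - (INR (S i) + INR (S p))) ^ S k).
      * intros M. rewrite lsum_window, !Rminus_0_l, !inv_pow_opp, Hj.
        rewrite (fsum_ext _ (fun u => / INR (S u) ^ S k))
          by (intros; do 2 f_equal; ring).
        rewrite <- hsum_fsum.
        rewrite (fsum_neg (S k) i _ (fun x => INR (S x))) by (intros; ring).
        rewrite <- hsum_fsum.
        rewrite (fsum_neg (S k) p _ (fun y => INR (S i) + INR (S y))) by (intros; ring).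
        rewrite (hsum_shift _ (S i) p) by trivial.
        rewrite (fsum_neg (S k) M _ (fun y => INR j + INR (S y))) by (intros; ring).
        rewrite (hsum_shift _ j M) by trivial.
        (* As [S i + p] is n - 1, this splits off the term of the excluded point n; the following
           [change] does the same for m. *)
        replace (hsum (S k) j) with (hsum (S k) (S i + p) + / INR j ^ S k)
          by (unfold j; rewrite Nat.add_succ_r; reflexivity).
        change (hsum (S k) (S i)) with (hsum (S k) i + / INR (S i) ^ S k).
        rewrite ?Nat.add_0_l. ring.
      * apply is_lim_seq_minus'; [apply is_lim_seq_minus'|]; try apply is_lim_seq_const.
        apply zcoef_lim.
    + eapply is_lim_seq_ext with (fun M =>
        (hsum (S k) (S i + M) + (-1) ^ S k * hsum (S k) (S p + M))
         - / (INR (S i) - 0) ^ S k - / (INR (S i) - (INR (S i) + INR (S p))) ^ S k).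
      * intros M. rewrite lsum_window, !Rminus_0_r.
        replace (INR (S i) - (INR (S i) + INR (S p))) with (- INR (S p)) by ring.
        rewrite !inv_pow_opp.
        rewrite (hsum_shift _ (S i) M) by (intros; ring).
        rewrite (hsum_rev _ 0 i).
        2:{ intros y Hy. rewrite ?Nat.add_0_l. rewrite minus_INR, !S_INR by lia. ring. }
        rewrite (fsum_neg (S k) p _ (fun x => INR (S x))) by (intros; ring).
        rewrite <- hsum_fsum.
        rewrite (fsum_neg (S k) M _ (fun y => INR (S p) + INR (S y))) by (intros; ring).
        rewrite (hsum_shift _ (S p) M) by trivial.
        change (hsum (S k) (S i)) with (hsum (S k) i + / INR (S i) ^ S k).
        change (hsum (S k) (S p)) with (hsum (S k) p + / INR (S p) ^ S k).
        change (hsum (S k) 0) with 0. rewrite ?Nat.add_0_l. ring.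
      * apply is_lim_seq_minus'; [apply is_lim_seq_minus'|]; try apply is_lim_seq_const.
        apply zcoef_lim.
    + eapply is_lim_seq_ext with (fun M =>
        (hsum (S k) (j + M) + (-1) ^ S k * hsum (S k) (0 + M))
         - / (INR (S i) + INR (S p) - 0) ^ S k
         - / (INR (S i) + INR (S p) - INR (S i)) ^ S k).
      * intros M. rewrite lsum_window, !Rminus_0_r.
        replace (INR (S i) + INR (S p) - INR (S i)) with (INR (S p)) by ring.
        rewrite Hj.
        rewrite (hsum_shift _ j M) by (intros; ring).
        rewrite (hsum_rev _ (S p) i).
        2:{ intros y Hy. rewrite <- Hj, plus_INR, minus_INR, !S_INR by lia. ring. }
        rewrite (hsum_rev _ 0 p).
        2:{ intros y Hy. rewrite ?Nat.add_0_l. rewrite <- Hj, minus_INR, !S_INR by lia. ring. }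
        rewrite (fsum_neg (S k) M _ (fun x => INR (S x))) by (intros; ring).
        rewrite <- hsum_fsum.
        replace (hsum (S k) j) with (hsum (S k) (S p + i) + / INR j ^ S k).
        2:{ unfold j. replace (S i + S p)%nat with (S (S p + i)) by lia. reflexivity. }
        change (hsum (S k) (S p)) with (hsum (S k) p + / INR (S p) ^ S k).
        change (hsum (S k) 0) with 0. rewrite !Nat.add_0_l. ring.
      * apply is_lim_seq_minus'; [apply is_lim_seq_minus'|]; try apply is_lim_seq_const.
        apply zcoef_lim.
Qed.

(** * Sums over pairs 0 < m < n *)

(* [m = S i] and [n = S j] run over the pairs [0 < m < n]. *)
Definition dsum (F : nat -> nat -> R) (l : R) : Prop :=
  is_lim_seq (fsum (fun j => fsum (fun i => F i j) j)) l.

Lemma dsum_ext F G l :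
  (forall i j, (i < j)%nat -> F i j = G i j) -> dsum F l -> dsum G l.
Proof.
  intros H. apply is_lim_seq_ext; intros n.
  apply fsum_ext; intros j _. apply fsum_ext; intros i Hi. now apply H.
Qed.

Lemma dsum_plus F G k l : dsum F k -> dsum G l -> dsum (fun i j => F i j + G i j) (k + l).
Proof.
  intros HF HG. eapply is_lim_seq_ext; [|exact (is_lim_seq_plus' _ _ _ _ HF HG)].
  intros n; cbv beta. rewrite <- fsum_plus. apply fsum_ext; intros j _. now rewrite fsum_plus.
Qed.

Lemma dsum_scal c F l : dsum F l -> dsum (fun i j => c * F i j) (c * l).
Proof.
  intros HF. eapply is_lim_seq_ext; [|exact (is_lim_seq_scal_l _ c _ HF)].
  intros n; cbv beta. rewrite <- fsum_scal. apply fsum_ext; intros j _. now rewrite fsum_scal.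
Qed.

Lemma dsum_fsum (F : nat -> nat -> nat -> R) (L : nat -> R) n :
  (forall k, (k < n)%nat -> dsum (F k) (L k)) ->
  dsum (fun i j => fsum (fun k => F k i j) n) (fsum L n).
Proof.
  intros H. eapply is_lim_seq_ext; [|exact (is_lim_seq_fsum _ _ _ H)].
  intros N; cbv beta. rewrite fsum_swap. apply fsum_ext; intros j _. now rewrite fsum_swap.
Qed.

(** The reflection m -> n - m: for m = [S i] and n = [S j], the difference n - m is
    [S (j - 1 - i)]. *)
Lemma dsum_rev F l : dsum F l -> dsum (fun i j => F (j - 1 - i)%nat j) l.
Proof.
  apply is_lim_seq_ext; intros n. apply fsum_ext; intros j _.
  now rewrite (fsum_rev (fun i => F i j)).
Qed.

Lemma dsum_unique F k l : dsum F k -> dsum F l -> k = l.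
Proof.
  intros Hk Hl. apply is_lim_seq_unique in Hk. apply is_lim_seq_unique in Hl.
  rewrite Hk in Hl. now injection Hl.
Qed.

Lemma dsum_zeta2 s1 s2 : (1 <= s1)%nat -> (2 <= s2)%nat ->
  dsum (fun i j => / INR (S i) ^ s1 * / INR (S j) ^ s2) (zeta2 s1 s2).
Proof.
  intros H1 H2. eapply is_lim_seq_ext; [|now apply hsum2_lim].
  intros n. rewrite hsum2_fsum. apply fsum_ext; intros j _.
  rewrite hsum_fsum, Rmult_comm, <- fsum_scal. apply fsum_ext; intros; ring.
Qed.

(** * The sum over x, range by range *)

(* Up to sign, the contribution of [x < 0], with [x = - S u], [m = S i], [n = S j]. *)
Definition outer_term (a b c i j u : nat) : R :=
  / INR (S u) ^ a * / (INR (S u) + INR (S i)) ^ b * / (INR (S u) + INR (S j)) ^ c.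

Definition outer (a b c i j : nat) : R := Series (outer_term a b c i j).

(* The contribution of [0 < x < m], with [S x] for [x]. *)
Definition inner (a b c i j : nat) : R :=
  fsum (fun x => / INR (S x) ^ a * / INR (i - x) ^ b * / INR (j - x) ^ c) i.

Lemma outer_term_ge0 a b c i j u : 0 <= outer_term a b c i j u.
Proof.
  unfold outer_term. rewrite <- !plus_INR, !Nat.add_succ_r.
  repeat apply Rmult_le_pos; apply Rlt_le, inv_pow_pos.
Qed.

Lemma ex_series_outer a b c i j : (2 <= a)%nat -> ex_series (outer_term a b c i j).
Proof.
  intros Ha. apply bounded_series with 2; [apply outer_term_ge0|].
  intros n. apply Rle_trans with (2 := hsum_bound a n Ha). rewrite hsum_fsum.
  apply fsum_le; intros u _. unfold outer_term. rewrite <- !plus_INR, !Nat.add_succ_r.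
  assert (H : forall k s, 0 <= / INR (S k) ^ s <= 1).
  { intros k s; split; [apply Rlt_le, inv_pow_pos|].
    replace 1 with (/ INR (S k) ^ 0) by (simpl; apply Rinv_1). apply inv_pow_le; lia. }
  rewrite <- (Rmult_1_r (/ INR (S u) ^ a)) at 2. rewrite Rmult_assoc.
  apply Rmult_le_compat_l; [apply H|].
  replace 1 with (1 * 1) by ring. apply Rmult_le_compat; apply H.
Qed.

(** In the ranges x < 0, 0 < x < m, m < x < n and x > n, respectively none, one, two and three of
    the bases are negative, whence the signs. The reflection x -> n - x gives the last two ranges
    the shape of the first two, with [a] and [c] exchanged and [p] in place of [i]. *)
Lemma residues_window a b c i p : (2 <= a)%nat -> (2 <= c)%nat ->
  let j := S (i + p) in
  residues 0 (INR (S i)) (INR (S i) + INR (S p)) a b c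
  = outer a b c i j + (-1) ^ a * inner a b c i j
    + (-1) ^ (a + b) * inner c b a p j + (-1) ^ (a + b + c) * outer c b a p j.
Proof.
  intros Ha Hc j.
  assert (Hj : INR (S i) + INR (S p) = INR (S j)).
  { rewrite <- plus_INR. f_equal. unfold j; lia. }
  assert (H : rat3_sum (window i p) 0 (INR (S i)) (INR (S i) + INR (S p)) a b c).
  { apply rat3_sum_lim with (a + b + c - 1)%nat; [lia|apply window_exhausts]. }
  apply is_lim_seq_unique in H.
  assert (H' : is_lim_seq
    (fun M => lsum (rat3 0 (INR (S i)) (INR (S i) + INR (S p)) a b c) (window i p M))
    (outer a b c i j + (-1) ^ a * inner a b c i j
    + (-1) ^ (a + b) * inner c b a p j + (-1) ^ (a + b + c) * outer c b a p j)).
  { apply is_lim_seq_ext with (fun M => fsum (outer_term a b c i j) M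
      + (-1) ^ a * inner a b c i j + (-1) ^ (a + b) * inner c b a p j
      + (-1) ^ (a + b + c) * fsum (outer_term c b a p j) M).
    - intros M. rewrite lsum_window. f_equal; [f_equal; [f_equal|]|].
      + apply fsum_ext; intros u _. unfold rat3, outer_term. rewrite Hj.
        now replace (0 - - INR (S u)) with (INR (S u)) by ring;
          replace (INR (S i) - - INR (S u)) with (INR (S u) + INR (S i)) by ring;
          replace (INR (S j) - - INR (S u)) with (INR (S u) + INR (S j)) by ring.
      + unfold inner. rewrite <- fsum_scal. apply fsum_ext; intros x Hx. unfold rat3.
        rewrite Hj, Rminus_0_l, inv_pow_opp, <- !minus_INR by (unfold j; lia).
        rewrite !Nat.sub_succ. ring.
      (* The point m + [S y] is at distance [p - y] from n, so the reflected sum has to be read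
         backwards. *)
      + unfold inner. rewrite <- fsum_rev, <- fsum_scal.
        apply fsum_ext; intros y Hy. unfold rat3.
        replace (S (p - 1 - y)) with (p - y)%nat by lia.
        replace (p - (p - 1 - y))%nat with (S y) by lia.
        replace (j - (p - 1 - y))%nat with (S i + S y)%nat by (unfold j; lia).
        replace (INR (S i) - (INR (S i) + INR (S y))) with (- INR (S y)) by ring.
        replace (INR (S i) + INR (S p) - (INR (S i) + INR (S y))) with (INR (p - y)).
        2:{ rewrite minus_INR, !S_INR by lia. ring. }
        rewrite Rminus_0_l, !inv_pow_opp, plus_INR, pow_add. ring.
      + rewrite <- fsum_scal. apply fsum_ext; intros z _. unfold rat3, outer_term.
        rewrite Hj.
        replace (0 - (INR (S j) + INR (S z))) with (- (INR (S z) + INR (S j))) by ring.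
        replace (INR (S i) - (INR (S j) + INR (S z))) with (- (INR (S z) + INR (S p)))
          by (rewrite <- Hj; ring).
        replace (INR (S j) - (INR (S j) + INR (S z))) with (- INR (S z)) by ring.
        rewrite !inv_pow_opp, !pow_add. ring.
    - apply (is_lim_seq_plus' (fun M => fsum (outer_term a b c i j) M
        + (-1) ^ a * inner a b c i j + (-1) ^ (a + b) * inner c b a p j)
        (fun M => (-1) ^ (a + b + c) * fsum (outer_term c b a p j) M)).
      + apply is_lim_seq_plus'; [|apply is_lim_seq_const].
        apply is_lim_seq_plus'; [|apply is_lim_seq_const].
        now apply lim_fsum_Series, ex_series_outer.
      + apply (is_lim_seq_scal_l _ ((-1) ^ (a + b + c)) (outer c b a p j)).
        now apply lim_fsum_Series, ex_series_outer. }
  apply is_lim_seq_unique in H'. rewrite H in H'. now injection H'.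
Qed.

(* The sum of [v^(-b) w^(-c)] over [s < v < w <= s + N], where [s = S u]. *)
Definition hsum2_above (b c u N : nat) : R :=
  fsum (fun j => fsum (fun i =>
    / (INR (S u) + INR (S i)) ^ b * / (INR (S u) + INR (S j)) ^ c) j) N.

Lemma hsum2_above_incr b c u n p : (n <= p)%nat ->
  hsum2_above b c u n <= hsum2_above b c u p.
Proof.
  apply fsum_incr; intros j. apply fsum_ge0; intros i _.
  rewrite <- !plus_INR, !Nat.add_succ_r. apply Rmult_le_pos; apply Rlt_le, inv_pow_pos.
Qed.

Lemma hsum2_above_ge0 b c u n : 0 <= hsum2_above b c u n.
Proof.
  apply Rle_trans with (hsum2_above b c u 0); [apply Rle_refl|apply hsum2_above_incr; lia].
Qed.

(** Triples are grouped by their smallest index [S u]; the two others lie above it and stay at most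
    [N]. *)
Lemma hsum3_above a b c N :
  hsum3 a b c N = fsum (fun u => / INR (S u) ^ a * hsum2_above b c u (N - 1 - u)) N.
Proof.
  unfold hsum3.
  rewrite (fsum_ext _ (fun w => fsum (fun u => / INR (S u) ^ a *
    fsum (fun y => / INR (S (S (u + y))) ^ b * / INR (S w) ^ c) (w - 1 - u)) w)).
  - rewrite fsum_triangle. apply fsum_ext; intros u _. rewrite fsum_scal. f_equal.
    unfold hsum2_above. apply fsum_ext; intros j _.
    replace (S (u + j) - 1 - u)%nat with j by lia. apply fsum_ext; intros i _.
    rewrite <- !plus_INR. do 2 f_equal; f_equal; f_equal; lia.
  - intros w _. rewrite hsum2_fsum.
    rewrite (fsum_ext _ (fun i => fsum (fun u => / INR (S u) ^ a * / INR (S i) ^ b) i)).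
    2:{ intros i _. rewrite hsum_fsum, Rmult_comm, <- fsum_scal.
        apply fsum_ext; intros; ring. }
    rewrite fsum_triangle, Rmult_comm, <- fsum_scal. apply fsum_ext; intros u _.
    rewrite <- !fsum_scal. apply fsum_ext; intros y _. ring.
Qed.

Lemma fsum_outer a b c N M :
  fsum (fun j => fsum (fun i => fsum (outer_term a b c i j) M) j) N
  = fsum (fun u => / INR (S u) ^ a * hsum2_above b c u N) M.
Proof.
  unfold hsum2_above.
  rewrite (fsum_ext _ (fun j => fsum (fun u => fsum (fun i => outer_term a b c i j u) j) M))
    by (intros; apply fsum_swap).
  rewrite fsum_swap. apply fsum_ext; intros u _. rewrite <- fsum_scal.
  apply fsum_ext; intros j _. rewrite <- fsum_scal. apply fsum_ext; intros i _.
  unfold outer_term. ring.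
Qed.

(** The indices are u < u + m < u + n, so the cutoff n <= N bounds the gap between largest and
    smallest index rather than the largest index itself. The partial sums [T N] are squeezed between
    [hsum3 a b c N] and the full sum. *)
Lemma dsum_outer a b c : (2 <= a)%nat -> (2 <= b)%nat -> (2 <= c)%nat ->
  dsum (outer a b c) (zeta3 a b c).
Proof.
  intros Ha Hb Hc. set (T := fsum (fun j => fsum (fun i => outer a b c i j) j)).
  assert (HT : forall N, is_lim_seq
    (fun M => fsum (fun u => / INR (S u) ^ a * hsum2_above b c u N) M) (T N)).
  { intros N. eapply is_lim_seq_ext; [intros M; apply fsum_outer|].
    apply (is_lim_seq_fsum (fun j M => fsum (fun i => fsum (outer_term a b c i j) M) j)).
    intros j _.
    apply (is_lim_seq_fsum (fun i M => fsum (outer_term a b c i j) M)).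
    intros i _. now apply lim_fsum_Series, ex_series_outer. }
  assert (Hterm : forall u n, 0 <= / INR (S u) ^ a * hsum2_above b c u n).
  { intros. apply Rmult_le_pos; [apply Rlt_le, inv_pow_pos|apply hsum2_above_ge0]. }
  apply is_lim_seq_le_le with (hsum3 a b c) (fun _ => zeta3 a b c).
  - intros N. split.
    + apply Rle_trans with (fsum (fun u => / INR (S u) ^ a * hsum2_above b c u N) N).
      * rewrite hsum3_above. apply fsum_le; intros u _.
        apply Rmult_le_compat_l; [apply Rlt_le, inv_pow_pos|apply hsum2_above_incr; lia].
      * apply (is_lim_seq_incr_compare
          (fun M => fsum (fun u => / INR (S u) ^ a * hsum2_above b c u N) M)); [apply HT|].
        intros n. apply fsum_incr; [intros; apply Hterm|lia].
    + apply (is_lim_seq_le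
        (fun M => fsum (fun u => / INR (S u) ^ a * hsum2_above b c u N) M)
        (fun _ => zeta3 a b c) (T N) (zeta3 a b c)); [|apply HT|apply is_lim_seq_const].
      (* With u at most M and n at most N, the largest index u + n is at most M + N. *)
      intros M. apply Rle_trans with (hsum3 a b c (M + N)); [|apply hsum3_le_zeta3; lia].
      rewrite hsum3_above.
      apply Rle_trans with
        (fsum (fun u => / INR (S u) ^ a * hsum2_above b c u (M + N - 1 - u)) M).
      * apply fsum_le; intros u Hu.
        apply Rmult_le_compat_l; [apply Rlt_le, inv_pow_pos|apply hsum2_above_incr; lia].
      * apply (fsum_incr (fun u => / INR (S u) ^ a * hsum2_above b c u (M + N - 1 - u)));
          [intros; apply Hterm|lia].
  - apply hsum3_lim; lia.
  - apply is_lim_seq_const.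
Qed.

(* Summed over [i], the inner sums are the terms of a Cauchy product. *)
Lemma fsum_inner a b c j :
  fsum (fun i => inner a b c i (S j)) (S j)
  = fsum (fun x => / INR (S x) ^ a * (hsum b (j - x) * / INR (S (j - x)) ^ c)) (S j).
Proof.
  unfold inner. rewrite fsum_triangle. apply fsum_ext; intros x Hx.
  replace (S j - 1 - x)%nat with (j - x)%nat by lia.
  replace (S (j - x)) with (S j - x)%nat by lia.
  rewrite hsum_fsum, (Rmult_comm (fsum _ _)), <- !fsum_scal. apply fsum_ext; intros y _.
  replace (S (x + y) - x)%nat with (S y) by lia. ring.
Qed.

(** A triple x < m < n amounts to x and the pair (m - x, n - x); as x and n - x add up to n,
    collecting by n gives a Cauchy product of nonnegative series. *)
Lemma dsum_inner a b c : (2 <= a)%nat -> (2 <= b)%nat -> (2 <= c)%nat ->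
  dsum (inner a b c) (Rzeta a * zeta2 b c).
Proof.
  intros Ha Hb Hc.
  assert (H1 : is_series (fun i => / INR (S i) ^ a) (Rzeta a)).
  { apply is_series_fsum. eapply is_lim_seq_ext; [apply hsum_fsum|now apply hsum_lim]. }
  assert (H2 : is_series (fun i => hsum b i * / INR (S i) ^ c) (zeta2 b c)).
  { apply is_series_fsum. eapply is_lim_seq_ext; [apply hsum2_fsum|apply hsum2_lim; lia]. }
  pose proof (is_series_mult_pos _ _ _ _ H1 H2
    (fun i => Rlt_le _ _ (inv_pow_pos i a)) (hsum2_term_ge0 b c)) as H.
  apply is_series_fsum in H.
  (* The index [j = 0], that is n = 1, admits no m; the Cauchy product starts one step later. *)
  apply is_lim_seq_incr_1. eapply is_lim_seq_ext; [|exact H].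
  intros n. cbv beta. rewrite (fsum_Sl _ n). cbn [fsum]. rewrite Rplus_0_l.
  apply fsum_ext; intros j _. rewrite <- fsum_sum_f_R0. symmetry. apply fsum_inner.
Qed.

(** * Explicit residues in powers of m, n - m and n *)

(* The case [s = 0] is again separate because [Binomial.C n k] is not [0] for [k > n]. *)
Definition multichoose (s k : nat) : R :=
  match s with
  | O => match k with O => 1 | S _ => 0 end
  | S s' => Binomial.C (k + s') k
  end.

Lemma negpow_multichoose d s k :
  negpow d s k = (-1) ^ k * (multichoose s k * / d ^ (s + k)).
Proof.
  destruct s as [|s]; [destruct k as [|k]|]; unfold negpow, multichoose; [simpl; field|ring|ring].
Qed.

(** Since (-d + t)^(-s) = (-1)^s (d - t)^(-s), the alternating signs of the expansion disappear. *)
Lemma negpow_neg d s k :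
  negpow (- d) s k = (-1) ^ s * (multichoose s k * / d ^ (s + k)).
Proof.
  rewrite negpow_multichoose, inv_pow_opp, pow_add.
  destruct (pow_m1_cases k) as [-> | ->]; ring.
Qed.

(* Partial fractions for [(r1 - x)^(-a) (r2 - x)^(-c)] with [d = r2 - r1]; the entries
   [g (S w) 0] and [g 0 (S w)] are the pure powers. *)
Lemma partial_fractions (g : nat -> nat -> R) d : d <> 0 ->
  (forall a c, d * g (S a) (S c) = g (S a) c - g a (S c)) ->
  forall w a c, (a + c = S w)%nat ->
  g a c = shift (conv (fun w => g (S w) 0%nat) (negpow d c)) a
    + shift (conv (fun w => g 0%nat (S w)) (negpow (- d) a)) c.
Proof.
  intros Hd Hg. induction w as [|w IH]; intros a c Hw.
  - destruct a as [|a]; simpl shift at 1.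
    + replace c with 1%nat by lia. cbn [shift]. rewrite conv_negpow_0; ring.
    + replace a with 0%nat by lia. replace c with 0%nat by lia. cbn [shift].
      rewrite conv_negpow_0; ring.
  - destruct a as [|a], c as [|c]; [lia| | |].
    + cbn [shift]. rewrite conv_negpow_0; ring.
    + cbn [shift]. rewrite conv_negpow_0; ring.
    + apply (Rmult_eq_reg_l d); trivial. rewrite Hg, (IH (S a) c), (IH a (S c)) by lia.
      cbn [shift].
      rewrite Rmult_plus_distr_l.
      rewrite (conv_lin_r d _ (negpow d c) (shift (negpow d (S c))))
        by (intros; now apply negpow_rec).
      match goal with |- _ = _ + d * ?x => replace (d * x) with (- (- d * x)) by ring end.
      rewrite (conv_lin_r (- d) _ (negpow (- d) a) (shift (negpow (- d) (S a))))
        by (intros; apply negpow_rec; lra).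
      rewrite !conv_shift_r. ring.
Qed.

(** Only even [k] matter, so the sign depends on [n] alone and can leave a sum over [k]. *)
Lemma zcoef_sign k n : (k <= n)%nat -> zcoef k * (-1) ^ (n - k) = (-1) ^ n * zcoef k.
Proof.
  intros H. replace n with (n - k + k)%nat at 2 by lia. rewrite pow_add. unfold zcoef.
  destruct (Nat.even k) eqn:E; [rewrite (pow_m1_even _ E)|]; ring.
Qed.

(** Up to sign, the residue at 0. With [a] and [c] exchanged and m replaced by n - m it is also the
    one at n. *)
Definition end_term (a b c i j : nat) : R :=
  fsum (fun k => zcoef k * fsum (fun w => multichoose b w * multichoose c (a - k - w)
    * (/ INR (S i) ^ (b + w) * / INR (S j) ^ (c + (a - k - w)))) (S (a - k))) (S a).

Definition end_sum (a b c : nat) : R :=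
  fsum (fun k => zcoef k * fsum (fun w => multichoose b w * multichoose c (a - k - w)
    * zeta2 (b + w) (c + (a - k - w))) (S (a - k))) (S a).

(** Up to sign, the half of the residue at m that involves powers of m and n only; the other half is
    its mirror image under m -> n - m. *)
Definition middle_term (a b c i j : nat) : R :=
  fsum (fun k => zcoef k * fsum (fun w => multichoose (S w) (b - k)
    * multichoose c (a - 1 - w)
    * (/ INR (S i) ^ (S w + (b - k)) * / INR (S j) ^ (c + (a - 1 - w)))) a) (S b).

Definition middle_sum (a b c : nat) : R :=
  fsum (fun k => zcoef k * fsum (fun w => multichoose (S w) (b - k)
    * multichoose c (a - 1 - w) * zeta2 (S w + (b - k)) (c + (a - 1 - w))) a) (S b).

Lemma dsum_end a b c : (1 <= b)%nat -> (2 <= c)%nat ->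
  dsum (end_term a b c) (end_sum a b c).
Proof.
  intros Hb Hc.
  apply (dsum_fsum (fun k i j => zcoef k * fsum (fun w => multichoose b w
    * multichoose c (a - k - w)
    * (/ INR (S i) ^ (b + w) * / INR (S j) ^ (c + (a - k - w)))) (S (a - k)))).
  intros k _. apply dsum_scal.
  apply (dsum_fsum (fun w i j => multichoose b w * multichoose c (a - k - w)
    * (/ INR (S i) ^ (b + w) * / INR (S j) ^ (c + (a - k - w))))).
  intros w _. apply dsum_scal, dsum_zeta2; lia.
Qed.

Lemma dsum_middle a b c : (2 <= c)%nat -> dsum (middle_term a b c) (middle_sum a b c).
Proof.
  intros Hc.
  apply (dsum_fsum (fun k i j => zcoef k * fsum (fun w => multichoose (S w) (b - k)
    * multichoose c (a - 1 - w)
    * (/ INR (S i) ^ (S w + (b - k)) * / INR (S j) ^ (c + (a - 1 - w)))) a)).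
  intros k _. apply dsum_scal.
  apply (dsum_fsum (fun w i j => multichoose (S w) (b - k) * multichoose c (a - 1 - w)
    * (/ INR (S i) ^ (S w + (b - k)) * / INR (S j) ^ (c + (a - 1 - w))))).
  intros w _. apply dsum_scal, dsum_zeta2; lia.
Qed.

Lemma residue_left a b c i j :
  conv zcoef (conv (negpow (INR (S i)) b) (negpow (INR (S j)) c)) a
  = (-1) ^ a * end_term a b c i j.
Proof.
  unfold end_term, conv. rewrite <- fsum_scal. apply fsum_ext; intros k Hk.
  rewrite <- Rmult_assoc, <- zcoef_sign, Rmult_assoc by lia. f_equal.
  rewrite <- fsum_scal. apply fsum_ext; intros w Hw.
  rewrite !negpow_multichoose.
  assert (E : (-1) ^ (a - k) = (-1) ^ w * (-1) ^ (a - k - w))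
    by (rewrite <- pow_add; f_equal; lia).
  rewrite E. ring.
Qed.

Lemma residue_right a b c p j :
  conv zcoef (conv (negpow (- INR (S j)) a) (negpow (- INR (S p)) b)) c
  = (-1) ^ (a + b) * end_term c b a p j.
Proof.
  rewrite (conv_ext _ zcoef _ (conv (negpow (- INR (S p)) b) (negpow (- INR (S j)) a)))
    by (trivial; intros; apply conv_comm).
  unfold end_term, conv. rewrite <- fsum_scal. apply fsum_ext; intros k Hk.
  rewrite <- Rmult_assoc, (Rmult_comm _ (zcoef k)), Rmult_assoc. f_equal.
  rewrite <- fsum_scal. apply fsum_ext; intros w Hw.
  rewrite !negpow_neg, (pow_add (-1)). ring.
Qed.

(** The expansions at m are centred at -m and n - m, which differ by n. Partial fractions in t with
    this difference separate powers of m from powers of n - m, at the cost of powers of n. *)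
Lemma residue_middle a b c i p : (1 <= a)%nat -> (1 <= c)%nat ->
  let j := S (i + p) in
  conv zcoef (conv (negpow (- INR (S i)) a) (negpow (INR (S p)) c)) b
  = (-1) ^ a * middle_term a b c i j + (-1) ^ (a + b) * middle_term c b a p j.
Proof.
  intros Ha Hc j.
  pose proof (INR_S_gt0 i) as Hi. pose proof (INR_S_gt0 p) as Hp.
  pose proof (INR_S_gt0 j) as Hj0.
  assert (Hj : INR (S j) = INR (S p) - - INR (S i)).
  { unfold Rminus; rewrite Ropp_involutive, <- plus_INR. f_equal. unfold j; lia. }
  rewrite (partial_fractions
    (fun x y => conv zcoef (conv (negpow (- INR (S i)) x) (negpow (INR (S p)) y)) b)
    (INR (S j))) with (w := (a + c - 1)%nat); [|lra| |lia].
  2:{ intros x y. apply conv_lin_r. intros k. rewrite Hj. apply conv_negpow_sub; lra. }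
  f_equal.
  - destruct a as [|a]; [lia|]. unfold middle_term.
    rewrite (fsum_ext (fun k => zcoef k * _) (fun k => fsum (fun w => zcoef k *
      (multichoose (S w) (b - k) * multichoose c (S a - 1 - w)
      * (/ INR (S i) ^ (S w + (b - k)) * / INR (S j) ^ (c + (S a - 1 - w))))) (S a)) (S b))
      by (intros; now rewrite fsum_scal).
    rewrite fsum_swap, <- fsum_scal. cbn [shift]. unfold conv at 1.
    apply fsum_ext; intros w Hw.
    rewrite (conv_ext _ zcoef _ (negpow (- INR (S i)) (S w)))
      by (trivial; intros; apply conv_negpow_0).
    unfold conv. rewrite Rmult_comm, <- !fsum_scal. apply fsum_ext; intros k Hk.
    rewrite negpow_neg, negpow_multichoose.
    replace (S a - 1 - w)%nat with (a - w)%nat by lia.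
    assert (E : (-1) ^ S a = (-1) ^ S w * (-1) ^ (a - w))
      by (rewrite <- pow_add; f_equal; lia).
    rewrite E. ring.
  - destruct c as [|c]; [lia|]. unfold middle_term.
    rewrite (fsum_ext (fun k => zcoef k * _) (fun k => fsum (fun w => zcoef k *
      (multichoose (S w) (b - k) * multichoose a (S c - 1 - w)
      * (/ INR (S p) ^ (S w + (b - k)) * / INR (S j) ^ (a + (S c - 1 - w))))) (S c)) (S b))
      by (intros; now rewrite fsum_scal).
    rewrite fsum_swap, <- fsum_scal. cbn [shift]. unfold conv at 1.
    apply fsum_ext; intros w Hw.
    rewrite (conv_ext _ zcoef _ (negpow (INR (S p)) (S w)))
      by (trivial; intros; rewrite conv_comm; apply conv_negpow_0).
    unfold conv. rewrite Rmult_comm, <- !fsum_scal. apply fsum_ext; intros k Hk.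
    rewrite negpow_neg, negpow_multichoose.
    replace (S c - 1 - w)%nat with (c - w)%nat by lia.
    transitivity (zcoef k * (-1) ^ (b - k) * ((-1) ^ a * (multichoose a (c - w)
      * / INR (S j) ^ (a + (c - w))) * (multichoose (S w) (b - k)
      * / INR (S p) ^ (S w + (b - k))))); [ring|].
    (* The sign (-1)^(b - k) comes from expanding around the positive n - m; it becomes (-1)^b. *)
    rewrite zcoef_sign, (pow_add (-1)) by lia. ring.
Qed.

(** * The relation between zeta values *)

(** One double sum over m < n is evaluated twice: by the four ranges of x, and by the residues at 0,
    n and m. *)
Lemma zeta_relation a b c : (2 <= a)%nat -> (2 <= b)%nat -> (2 <= c)%nat ->
  zeta3 a b c + (-1) ^ a * (Rzeta a * zeta2 b c)
  + (-1) ^ (a + b) * (Rzeta c * zeta2 b a) + (-1) ^ (a + b + c) * zeta3 c b a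
  = (-1) ^ a * end_sum a b c + (-1) ^ (a + b) * end_sum c b a
  + ((-1) ^ a * middle_sum a b c + (-1) ^ (a + b) * middle_sum c b a).
Proof.
  intros Ha Hb Hc.
  apply (dsum_unique (fun i j => outer a b c i j + (-1) ^ a * inner a b c i j
    + (-1) ^ (a + b) * inner c b a (j - 1 - i) j
    + (-1) ^ (a + b + c) * outer c b a (j - 1 - i) j)).
  - apply dsum_plus; [apply dsum_plus; [apply dsum_plus|]|].
    + now apply dsum_outer.
    + now apply dsum_scal, dsum_inner.
    + now apply dsum_scal, (dsum_rev (inner c b a)), dsum_inner.
    + now apply dsum_scal, (dsum_rev (outer c b a)), dsum_outer.
  - apply dsum_ext with (fun i j =>
      (-1) ^ a * end_term a b c i j + (-1) ^ (a + b) * end_term c b a (j - 1 - i) j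
      + ((-1) ^ a * middle_term a b c i j
         + (-1) ^ (a + b) * middle_term c b a (j - 1 - i) j)).
    + intros i j Hij. set (p := (j - 1 - i)%nat).
      replace j with (S (i + p)) by (unfold p; lia).
      rewrite <- residues_window, <- residue_middle, <- residue_left, <- residue_right by lia.
      assert (Hj : INR (S (S (i + p))) = INR (S i) + INR (S p)).
      { rewrite <- plus_INR. f_equal. lia. }
      rewrite Hj. unfold residues.
      rewrite !Rminus_0_r, !Rminus_0_l.
      replace (INR (S i) + INR (S p) - INR (S i)) with (INR (S p)) by ring.
      replace (INR (S i) - (INR (S i) + INR (S p))) with (- INR (S p)) by ring.
      ring.
    + apply dsum_plus; apply dsum_plus; apply dsum_scal.
      * apply dsum_end; lia.
      * apply (dsum_rev (end_term c b a)), dsum_end; lia.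
      * now apply dsum_middle.
      * now apply (dsum_rev (middle_term c b a)), dsum_middle.
Qed.

(** * Translation into the binomial sums of the theorem *)

(** Odd [k] contribute nothing, and even ones are written [k = 2 * xi]; for odd [n] the last term
    vanishes, which explains the integer part. *)
Lemma fsum_zcoef (F : nat -> R) n :
  fsum (fun k => zcoef k * F k) (S n)
  = 2 * sum_f_R0 (fun xi => Rzeta (2 * xi) * F (2 * xi)%nat) (n / 2).
Proof.
  assert (He : forall h, zcoef (2 * h) = 2 * Rzeta (2 * h)).
  { intros h. unfold zcoef. now rewrite Nat.even_mul. }
  assert (Ho : forall h, zcoef (S (2 * h)) = 0).
  { intros h. unfold zcoef. now rewrite Nat.even_succ, Nat.odd_mul. }
  assert (H : forall h, fsum (fun k => zcoef k * F k) (S (2 * h))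
    = 2 * sum_f_R0 (fun xi => Rzeta (2 * xi) * F (2 * xi)%nat) h).
  { induction h as [|h IH].
    - simpl. rewrite zcoef_0. lra.
    - rewrite tech5, Rmult_plus_distr_l, <- IH, <- (Rmult_assoc 2), <- He.
      replace (2 * S h)%nat with (S (S (2 * h))) by lia.
      cbn [fsum]. rewrite Ho. ring. }
  destruct (Nat.Even_or_Odd n) as [[h ->]|[h ->]].
  - rewrite H. do 2 f_equal. apply Nat.div_unique with 0%nat; lia.
  - rewrite Nat.add_1_r. cbn [fsum]. rewrite Ho.
    change (fsum (fun k => zcoef k * F k) (2 * h) + zcoef (2 * h) * F (2 * h)%nat)
      with (fsum (fun k => zcoef k * F k) (S (2 * h))).
    rewrite H. replace (S (2 * h) / 2)%nat with h; [ring|].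
    apply Nat.div_unique with 1%nat; lia.
Qed.

Lemma multichoose_C s k n : (1 <= s)%nat -> n = (k + s - 1)%nat ->
  multichoose s k = Binomial.C n k.
Proof. intros Hs ->. destruct s as [|s]; [lia|]. simpl. f_equal; lia. Qed.

Lemma multichoose_C_sym s k n r : (1 <= s)%nat -> n = (k + s - 1)%nat -> r = (s - 1)%nat ->
  multichoose s k = Binomial.C n r.
Proof.
  intros Hs Hn Hr. rewrite (multichoose_C s k n), pascal_step1 by lia.
  f_equal; lia.
Qed.

Lemma end_sum_C a b c : (1 <= b)%nat -> (1 <= c)%nat ->
  end_sum a b c = 2 * sum_f_R0 (fun xi => Rzeta (2 * xi)%nat *
        sum_f_R0 (fun w =>
          Binomial.C (w + b - 1)%nat w * Binomial.C (a + c - 2 * xi - w - 1)%nat (c - 1)%nat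
          * zeta2 (b + w)%nat (a + c - 2 * xi - w)%nat) (a - 2 * xi)%nat) (a / 2)%nat.
Proof.
  intros Hb Hc. unfold end_sum.
  rewrite (fsum_zcoef (fun k => fsum (fun w => multichoose b w * multichoose c (a - k - w)
    * zeta2 (b + w) (c + (a - k - w))) (S (a - k)))).
  f_equal. apply sum_eq; intros xi Hxi.
  assert (2 * xi <= a)%nat by (pose proof (Nat.Div0.mul_div_le a 2); lia).
  f_equal. rewrite fsum_sum_f_R0. apply sum_eq; intros w Hw.
  f_equal; [f_equal|f_equal; lia].
  - apply multichoose_C; lia.
  - apply multichoose_C_sym; lia.
Qed.

Lemma middle_sum_C a b c : (1 <= a)%nat -> (1 <= c)%nat ->
  middle_sum a b c = 2 * sum_f_R0 (fun xi => Rzeta (2 * xi)%nat *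
        sum_f_R0 (fun w =>
          Binomial.C (w + b - 2 * xi)%nat w * Binomial.C (a + c - w - 2)%nat (c - 1)%nat
          * zeta2 (b - 2 * xi + w + 1)%nat (a + c - 1 - w)%nat) (a - 1)%nat) (b / 2)%nat.
Proof.
  intros Ha Hc. unfold middle_sum.
  rewrite (fsum_zcoef (fun k => fsum (fun w => multichoose (S w) (b - k)
    * multichoose c (a - 1 - w) * zeta2 (S w + (b - k)) (c + (a - 1 - w))) a)).
  f_equal. apply sum_eq; intros xi Hxi.
  assert (2 * xi <= b)%nat by (pose proof (Nat.Div0.mul_div_le b 2); lia).
  f_equal. rewrite <- fsum_sum_f_R0. replace (S (a - 1)) with a by lia.
  apply fsum_ext; intros w Hw.
  f_equal; [f_equal|f_equal; lia].
  - apply multichoose_C_sym; lia.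
  - apply multichoose_C_sym; lia.
Qed.

Theorem theorem5p2 (a b c : nat) (ha : (2 <= a)%nat) (hb : (2 <= b)%nat)
  (hc : (2 <= c)%nat) :
  (1 + (-1) ^ a) * zeta3 a b c
  + (1 + (-1) ^ b) * (zeta3 b a c + zeta3 b c a)
  + (-1) ^ b * (1 + (-1) ^ c) * zeta3 c b a
  = 2 * (
      sum_f_R0 (fun xi => Rzeta (2 * xi)%nat *
        sum_f_R0 (fun w =>
          Binomial.C (w + b - 1)%nat w * Binomial.C (a + c - 2 * xi - w - 1)%nat (c - 1)%nat
          * zeta2 (b + w)%nat (a + c - 2 * xi - w)%nat) (a - 2 * xi)%nat) (a / 2)%nat
    + sum_f_R0 (fun xi => Rzeta (2 * xi)%nat *
        sum_f_R0 (fun w =>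
          Binomial.C (w + b - 2 * xi)%nat w * Binomial.C (a + c - w - 2)%nat (c - 1)%nat
          * zeta2 (b - 2 * xi + w + 1)%nat (a + c - 1 - w)%nat) (a - 1)%nat) (b / 2)%nat
    + (-1) ^ b * sum_f_R0 (fun xi => Rzeta (2 * xi)%nat *
        sum_f_R0 (fun w =>
          Binomial.C (w + b - 1)%nat w * Binomial.C (a + c - 2 * xi - w - 1)%nat (a - 1)%nat
          * zeta2 (b + w)%nat (a + c - 2 * xi - w)%nat) (c - 2 * xi)%nat) (c / 2)%nat
    + (-1) ^ b * sum_f_R0 (fun xi => Rzeta (2 * xi)%nat *
        sum_f_R0 (fun w =>
          Binomial.C (w + b - 2 * xi)%nat w * Binomial.C (a + c - w - 2)%nat (a - 1)%nat
          * zeta2 (b - 2 * xi + w + 1)%nat (a + c - 1 - w)%nat) (c - 1)%nat) (b / 2)%nat)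
    - zeta2 (a + b)%nat c - (1 + (-1) ^ b) * zeta2 b (a + c)%nat
    - (-1) ^ b * zeta2 (b + c)%nat a.
Proof.
  pose proof (zeta_relation a b c ha hb hc) as H.
  (* The stuffle product supplies the remaining triple zeta values and the isolated double ones. *)
  rewrite !Rzeta_mul_zeta2 in H by lia.
  rewrite !Rmult_plus_distr_l, <- (end_sum_C a b c), <- (middle_sum_C a b c) by lia.
  rewrite <- !(Rmult_assoc 2), !(Rmult_comm 2 ((-1) ^ b)), !(Rmult_assoc ((-1) ^ b) 2).
  (* The third and fourth sums are the first two with [a] and [c] exchanged. *)
  replace (sum_f_R0 (fun xi => Rzeta (2 * xi)%nat *
        sum_f_R0 (fun w =>
          Binomial.C (w + b - 1)%nat w * Binomial.C (a + c - 2 * xi - w - 1)%nat (a - 1)%nat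
          * zeta2 (b + w)%nat (a + c - 2 * xi - w)%nat) (c - 2 * xi)%nat) (c / 2)%nat)
    with (end_sum c b a / 2).
  2:{ rewrite end_sum_C, (Nat.add_comm a c) by lia. field. }
  replace (sum_f_R0 (fun xi => Rzeta (2 * xi)%nat *
        sum_f_R0 (fun w =>
          Binomial.C (w + b - 2 * xi)%nat w * Binomial.C (a + c - w - 2)%nat (a - 1)%nat
          * zeta2 (b - 2 * xi + w + 1)%nat (a + c - 1 - w)%nat) (c - 1)%nat) (b / 2)%nat)
    with (middle_sum c b a / 2).
  2:{ rewrite middle_sum_C, (Nat.add_comm a c) by lia. field. }
  rewrite !pow_add in H. rewrite !(Nat.add_comm c) in H.
  (* [H] is the goal up to the factor (-1)^a; in each parity case both are linear in the zeta values
     and sums. *)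
  destruct (pow_m1_cases a) as [Ea|Ea], (pow_m1_cases b) as [Eb|Eb],
    (pow_m1_cases c) as [Ec|Ec]; rewrite ?Ea, ?Eb, ?Ec in *; lra.
Qed.
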